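(* Let $n$ be a positive integer, let $d=\frac{5^n-3}{2}$, and let $F(x)=x^d$ over $\mathbb{F}_{5^n}$. Then the $(-1)$-differential uniformity of $F$ is ${}_{-1}\Delta_F=2$.
   Context: For a function $F:\mathbb{F}_q\to\mathbb{F}_q$ and $a,b,c\in\mathbb{F}_q$, define ${}_c\delta_F(a,b)=\#\{x\in\mathbb{F}_q : F(x+a)-cF(x)=b\}$. The $c$-differential uniformity is ${}_c\Delta_F=\max\{{}_c\delta_F(a,b) : a,b\in\mathbb{F}_q,\ \text{and } a\neq 0 \text{ if } c=1\}$. Here $c=-1$.
   Formalization: The claim is proved for n ≥ 2 rather than for every positive n: for n = 1 one has d = 1 and F(x) = x over F_5, so F(x+a)+F(x) = 2x+a is a permutation and the (-1)-differential uniformity is 1, not 2. *)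

(* Defs.v *)
From HB Require Import structures.
From mathcomp Require Import all_boot all_order all_algebra.
Set Implicit Arguments. Unset Strict Implicit. Unset Printing Implicit Defensive.
Import GRing.Theory.
Local Open Scope ring_scope.

Definition cdelta (K : finFieldType) (c : K) (f : K -> K) (a b : K) : nat :=
  #|[set x : K | f (x + a) - c * f x == b]|.

(* The direction a = 0 is excluded only when c = 1. *)
Definition cdiff_uniformity (K : finFieldType) (c : K) (f : K -> K) : nat :=
  \max_(a : K | (c == 1) ==> (a != 0)) \max_(b : K) cdelta c f a b.

(* Main.v *)
(* With [q = 5 ^ n] and [chi] the quadratic character, [x ^ d = chi x / x] for
   [x != 0]; scaling reduces [a != 0] to [a = 1].
   - If [chi x = chi (x + 1)], then, up to [x |-> -1 - x], a solution satisfies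
     [b x (x + 1) = 2 x + 1], at most two values. In characteristic 5,
     [(b + 1) x (x + 1) = (x - 1)^2] and [(b - 1) x (x + 1) = - (x + 2)^2], so
     neither [b + 1] nor [b - 1] is a nonsquare.
   - If [chi x = - chi (x + 1)], then [b x (x + 1) = chi x], with at most one
     solution for each sign. Moreover [b] is a nonsquare, and so is [b - chi x]
     because [(b - chi x) x (x + 1)] is [(x - 2)^2] up to sign.
   The two kinds therefore never occur together, whence the upper bound. Two
   solutions exist as soon as [b + 1] and [b - 1] are both nonzero squares and
   [b != 0]. *)
Require Import Defs.
From HB Require Import structures.
From mathcomp Require Import all_boot all_order all_algebra.
From mathcomp Require Import finfield ring zify.
Set Implicit Arguments. Unset Strict Implicit. Unset Printing Implicit Defensive.
Import GRing.Theory.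
Local Open Scope ring_scope.

(** * General rings and finite fields *)

(** Reduces a goal to a [ring] identity modulo a known equation; with [5 = 0] as that equation, it
    computes in characteristic 5. *)
Lemma eq_multiple (R : comPzRingType) (k u v a b : R) :
  u = v -> a - b = k * (u - v) -> a = b.
Proof. by move=> -> /eqP; rewrite subrr mulr0 subr_eq0 => /eqP. Qed.

Lemma exists_expfn_neq (F : finFieldType) (m : nat) :
  (1 < m < #|F|)%N -> exists w : F, w ^+ m != w.
Proof.
case/andP=> m_gt1 m_lt; case: (pickP (fun w : F => w ^+ m != w)) => [w|powE].
  by exists w.
have szp : size ('X^m - 'X : {poly F}) = m.+1.
  by rewrite size_polyDl ?size_polyXn // size_polyN size_polyX ltnS.
have p_neq0 : 'X^m - 'X != 0 :> {poly F} by rewrite -size_poly_eq0 szp.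
suff /(max_poly_roots p_neq0)/(_ (enum_uniq _)) : all (root ('X^m - 'X)) (enum F).
  by rewrite szp -cardE ltnS leqNgt m_lt.
apply/allP => w _; rewrite /root !hornerE subr_eq0.
exact: negbFE (powE w).
Qed.

(** * The quadratic character *)

Section QuadraticCharacter.
Variables (K : finFieldType) (d : nat).
Hypothesis cardK : #|K| = (2 * d + 3)%N.
Hypothesis odd_d : odd d.
Hypothesis char5 : 5%:R = 0 :> K.

(** As [#|K| = 2 * d + 3], the exponent is half the order of the unit group, so this is the
    quadratic character; [odd d] makes -1 a square. *)
Local Notation chi x := ((x : K) ^+ d.+1).

Lemma neq1N1 : (1 : K) != -1.
Proof.
apply/eqP => h; have /eqP : (1 : K) = 0; last by rewrite oner_eq0.
have h2 : (2 : K) = 0 by apply: (eq_multiple (k := 1) h); ring.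
have -> : (1 : K) = 5%:R - 2 * 2 by ring.
by rewrite char5 h2; ring.
Qed.

Lemma two_neq0 : (2 : K) != 0.
Proof. by apply: contra neq1N1 => /eqP h; apply/eqP/(eq_multiple (k := 1) h); ring. Qed.

Lemma chi0 : chi 0 = 0. Proof. by rewrite expr0n. Qed.

Lemma chiN x : chi (- x) = chi x.
Proof. by rewrite exprNn -signr_odd /= odd_d expr0 mul1r. Qed.

Lemma chi_sign (x : K) : x != 0 -> chi x = 1 \/ chi x = -1.
Proof.
move=> x0; suff /eqP : chi x ^+ 2 = 1 by rewrite sqrf_eq1 => /orP[] /eqP; [left|right].
apply: (mulfI x0); rewrite mulr1 -exprM -exprS -[RHS]expf_card cardK.
by congr (_ ^+ _); lia.
Qed.

Lemma chi_sqr_neq (u : K) : chi (u ^+ 2) != -1.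
Proof.
have [->|u0] := eqVneq u 0.
  by rewrite expr0n chi0 -subr_eq0 opprK add0r oner_eq0.
rewrite exprAC; case: (chi_sign u0) => ->; rewrite ?sqrrN expr1n; exact: neq1N1.
Qed.

Lemma exp_chi (x : K) : x ^+ d * x = chi x.
Proof. by rewrite -exprSr. Qed.

Lemma sum_chi (b x : K) : (x + 1) ^+ d + x ^+ d = b ->
  b * (x * (x + 1)) = chi (x + 1) * x + chi x * (x + 1).
Proof. by move=> <-; rewrite -!exp_chi; ring. Qed.

Lemma expfN (x : K) : (- x) ^+ d = - x ^+ d.
Proof. by rewrite exprNn -signr_odd odd_d mulN1r. Qed.

Lemma sum_refl (x : K) : (- 1 - x + 1) ^+ d + (- 1 - x) ^+ d = - ((x + 1) ^+ d + x ^+ d).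
Proof.
have -> : - 1 - x + 1 = - x by ring.
have -> : - 1 - x = - (x + 1) by ring.
by rewrite !expfN; ring.
Qed.

(** * Solutions by type *)

Definition same_type (x : K) := [&& x != 0, x + 1 != 0 & chi (x + 1) == chi x].
Definition mixed_type (x : K) := [&& x != 0, x + 1 != 0 & chi (x + 1) == - chi x].

Lemma sum_cases (b x : K) : (x + 1) ^+ d + x ^+ d = b ->
  [\/ x = 0 /\ b = 1, x = -1 /\ b = -1, same_type x | mixed_type x].
Proof.
have d0 : d != 0%N by case: (d) odd_d.
have [-> <-|x0 hb] := eqVneq x 0.
  by constructor 1; rewrite add0r expr1n expr0n (negPf d0) addr0.
have [x1|x1] := eqVneq (x + 1) 0.
  have xE : x = -1 by apply/eqP; rewrite -addr_eq0 x1.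
  constructor 2; split=> //; rewrite -hb x1 xE expr0n (negPf d0) add0r.
  by rewrite -signr_odd odd_d.
rewrite /same_type /mixed_type x0 x1 /=.
case: (chi_sign x0) (chi_sign x1) => -> [] ->; rewrite ?opprK eqxx;
  by [constructor 3 | constructor 4].
Qed.

(* Reflecting [x] through [x |-> -1 - x] when [chi x = -1] brings every solution
   of same type to one fixed quadratic equation. *)
Definition normal (x : K) := if chi x == 1 then x else -1 - x.

Lemma same_type_normal (b x : K) : (x + 1) ^+ d + x ^+ d = b -> same_type x ->
  b * (normal x * (normal x + 1)) = 2 * normal x + 1
  /\ chi (normal x * (normal x + 1)) = 1.
Proof.
move=> /sum_chi hb /and3P[x0 x1 /eqP h]; rewrite /normal exprMn.
have N1 : chi (-1 - x) = chi x by rewrite -h -chiN; congr (_ ^+ _); ring.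
have N2 : chi (-1 - x + 1) = chi x by rewrite -chiN; congr (_ ^+ _); ring.
move: hb; rewrite h; case: (chi_sign x0) => e.
  by rewrite e eqxx h e mulr1 => -> ; split=> //; ring.
rewrite e eq_sym (negPf neq1N1) N1 N2 e mulrNN mulr1 => hb; split=> //.
by apply: (eq_multiple (k := 1) hb); ring.
Qed.

(** A collision of distinct points would need [u = -1 - v] with opposite characters, but reflecting
    a point of same type keeps its character. *)
Lemma normal_inj (x y : K) : same_type x -> same_type y -> normal x = normal y -> x = y.
Proof.
have no_refl u v : same_type v -> chi u = 1 -> chi v = -1 -> u <> -1 - v.
  move=> /and3P[_ _ /eqP hv] hu hv' uv; case/eqP: neq1N1.
  by rewrite -[LHS]hu -hv' -hv -chiN uv; congr (_ ^+ _); ring.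
move=> hx hy; rewrite /normal.
have [[x0 _ _] [y0 _ _]] := (and3P hx, and3P hy).
case: (chi_sign x0) (chi_sign y0) => ex [] ey; 
  rewrite ex ey ?eqxx ?(eq_sym (-1) 1) ?(negPf neq1N1) //.
- by move/(no_refl _ _ hy ex ey).
- by move/esym/(no_refl _ _ hx ey ex).
- by move/addrI/oppr_inj.
Qed.

Lemma same_type_addr1 (b x : K) : (x + 1) ^+ d + x ^+ d = b -> same_type x ->
  (b + 1) * (normal x * (normal x + 1)) = (normal x - 1) ^+ 2.
Proof.
move=> hb hx; have [E _] := same_type_normal hb hx; rewrite mulrDl E.
by apply: (eq_multiple (k := normal x) char5); ring.
Qed.

Lemma same_type_subr1 (b x : K) : (x + 1) ^+ d + x ^+ d = b -> same_type x ->
  (b - 1) * (normal x * (normal x + 1)) = - (normal x + 2) ^+ 2.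
Proof.
move=> hb hx; have [E _] := same_type_normal hb hx; rewrite mulrBl E.
by apply: (eq_multiple (k := normal x + 1) char5); ring.
Qed.

Lemma same_type_chi (b x : K) : (x + 1) ^+ d + x ^+ d = b -> same_type x ->
  chi (b + 1) != -1 /\ chi (b - 1) != -1.
Proof.
move=> hb hx; have [_ E] := same_type_normal hb hx.
have mulE u : chi u = chi (u * (normal x * (normal x + 1))) by rewrite exprMn E mulr1.
by rewrite (mulE (b + 1)) (mulE (b - 1)) (same_type_addr1 hb hx) (same_type_subr1 hb hx) chiN !chi_sqr_neq.
Qed.

Lemma mixed_type_eq (b x : K) : (x + 1) ^+ d + x ^+ d = b -> mixed_type x ->
  b * (x * (x + 1)) = chi x /\ chi (x * (x + 1)) = -1.
Proof.
move=> /sum_chi -> /and3P[x0 _ /eqP h]; rewrite exprMn h; split; first by ring.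
by case: (chi_sign x0) => ->; ring.
Qed.

Lemma mixed_type_chi (b x : K) : (x + 1) ^+ d + x ^+ d = b -> mixed_type x ->
  chi b = -1 /\ chi (b - chi x) = -1.
Proof.
move=> hb hx; have [E1 E2] := mixed_type_eq hb hx.
have [x0 x1 /eqP h] := and3P hx.
(* Makes the character of [(x - 2) ^+ 2] equal to 1 rather than 0. *)
have x2 : x - 2 != 0.
  apply: contra neq1N1; rewrite subr_eq0 => /eqP xE.
  have E : x + 1 = - x.
    by rewrite xE; apply: (eq_multiple (k := 1) char5); ring.
  move: h; rewrite E chiN.
  by case: (chi_sign x0) => -> e; apply/eqP => //; rewrite [RHS]e opprK.
have mulE u : chi (u * (x * (x + 1))) = 1 -> chi u = -1.
  by rewrite exprMn E2 mulrN1 => <-; rewrite opprK.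
split; apply: mulE; first by rewrite E1; case: (chi_sign x0) => ->; rewrite ?chiN expr1n.
suff -> : chi ((b - chi x) * (x * (x + 1))) = chi ((x - 2) ^+ 2).
  by have := chi_sign (expf_neq0 2 x2); case=> // /eqP; rewrite (negPf (chi_sqr_neq _)).
have s : (x - 2) ^+ 2 = x * (x + 1) - 1.
  by apply: (eq_multiple (k := 1 - x) char5); ring.
rewrite s mulrBl E1; case: (chi_sign x0) => ->; last by congr (_ ^+ _); ring.
by rewrite -chiN; congr (_ ^+ _); ring.
Qed.

(** Here [x * (x + 1) = y * (y + 1)], so [y] is [x] or its reflection; on mixed points the
    reflection flips the character. *)
Lemma mixed_type_uniq (b x y : K) : b != 0 ->
  (x + 1) ^+ d + x ^+ d = b -> (y + 1) ^+ d + y ^+ d = b ->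
  mixed_type x -> mixed_type y -> chi x = chi y -> x = y.
Proof.
move=> b0 hx hy tx ty e.
have [[E1 _] [E2 _]] := (mixed_type_eq hx tx, mixed_type_eq hy ty).
have /(mulfI b0) E : b * (x * (x + 1)) = b * (y * (y + 1)) by rewrite E1 E2.
have : (x - y) * (x + y + 1) == 0.
  by apply/eqP/(eq_multiple (k := 1) E); ring.
rewrite mulf_eq0 subr_eq0 => /orP[/eqP //|/eqP s].
have [x0 _ /eqP] := and3P tx.
have -> : x + 1 = - y by apply: (eq_multiple (k := 1) s); ring.
rewrite chiN -e; case: (chi_sign x0) => -> h; have := neq1N1.
  by rewrite -h eqxx.
by rewrite h opprK eqxx.
Qed.

(** By Vieta, distinct roots [u], [v] of the quadratic satisfy [b * (u + v) = 2 - b], so a root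
    different from [normal x] is determined by it. *)
Lemma same_type_three (b x y z : K) : b != 0 ->
  (x + 1) ^+ d + x ^+ d = b -> (y + 1) ^+ d + y ^+ d = b -> (z + 1) ^+ d + z ^+ d = b ->
  same_type x -> same_type y -> same_type z -> [\/ x = y, y = z | z = x].
Proof.
move=> b0 hx hy hz tx ty tz.
have [[E1 _] [E2 _] [E3 _]] :=
  And3 (same_type_normal hx tx) (same_type_normal hy ty) (same_type_normal hz tz).
have [/(normal_inj tx ty)|n1] := eqVneq (normal x) (normal y); first by constructor 1.
have [/(normal_inj tz tx)|n2] := eqVneq (normal z) (normal x); first by constructor 3.
constructor 2; apply: normal_inj => //.
have sum (u v : K) : u != v -> b * (u * (u + 1)) = 2 * u + 1 -> b * (v * (v + 1)) = 2 * v + 1 ->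
    b * (u + v) = 2 - b.
  rewrite -subr_eq0 => uv Eu Ev; apply: (mulfI uv); apply/eqP; rewrite -subr_eq0.
  have -> : (u - v) * (b * (u + v)) - (u - v) * (2 - b) =
    (b * (u * (u + 1)) - (2 * u + 1)) - (b * (v * (v + 1)) - (2 * v + 1)) by ring.
  by rewrite Eu Ev !subrr.
have S := sum _ _ n1 E1 E2; move: n2; rewrite eq_sym => n2.
by have := sum _ _ n2 E1 E3; rewrite -S => /(mulfI b0)/addrI.
Qed.

(** * At most two solutions in direction 1 *)

Lemma no_three_solutions (b x y z : K) :
  (x + 1) ^+ d + x ^+ d = b -> (y + 1) ^+ d + y ^+ d = b -> (z + 1) ^+ d + z ^+ d = b ->
  [\/ x = y, y = z | z = x].
Proof.
have [-> hx hy _|b0 hx hy hz] := eqVneq b 0.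
  constructor 1.
  (* For [b = 0] the only possible solution is the fixed point of the reflection. *)
  have mid (u : K) : (u + 1) ^+ d + u ^+ d = 0 -> 2 * u + 1 = 0.
    move=> hu; case: (sum_cases hu) => [[_ /eqP]|[_ /eqP]|tu|tu].
    - by rewrite eq_sym oner_eq0.
    - by rewrite eq_sym oppr_eq0 oner_eq0.
    - have [E _] := same_type_normal hu tu; move: E; rewrite mul0r /normal.
      case: ifP => _ // E; apply: (eq_multiple (k := 1) E); ring.
    - have [E _] := mixed_type_eq hu tu; have [u0 _ _] := and3P tu.
      by move: E u0; rewrite mul0r => /esym/eqP; rewrite expf_eq0 => /andP[_ ->].
  apply: (mulfI two_neq0); apply: (addIr 1).
  by rewrite !mid.
(* A mixed solution rules out [b = 1] and [b = -1] by [chi b = -1], and the same type by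
   [chi (b - chi u) = -1]. *)
have mixed_all (u v : K) : (u + 1) ^+ d + u ^+ d = b -> (v + 1) ^+ d + v ^+ d = b ->
    mixed_type u -> mixed_type v.
  move=> hu hv tu; have [B1 B2] := mixed_type_chi hu tu.
  have [u0 _ _] := and3P tu.
  case: (sum_cases hv) => [[_ bE]|[_ bE]|tv|//].
  - by have := neq1N1; rewrite -B1 bE expr1n eqxx.
  - by have := neq1N1; rewrite -B1 bE chiN expr1n eqxx.
  - have [/eqP nP /eqP nM] := same_type_chi hv tv.
    by move: B2; case: (chi_sign u0) => ->; rewrite ?opprK.
have [tx|tx] := boolP (mixed_type x).
  have ty := mixed_all _ _ hx hy tx; have tz := mixed_all _ _ hx hz tx.
  have [[x0 _ _] [y0 _ _] [z0 _ _]] := And3 (and3P tx) (and3P ty) (and3P tz).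
  have U := mixed_type_uniq b0.
  case: (chi_sign x0) (chi_sign y0) (chi_sign z0) => ex [] ey [] ez;
  first [ by constructor 1; apply: U; rewrite ?ex ?ey
        | by constructor 2; apply: U; rewrite ?ey ?ez
        | by constructor 3; apply: U; rewrite ?ex ?ez ].
have not_mixed (u : K) : (u + 1) ^+ d + u ^+ d = b -> mixed_type u -> False.
  by move=> hu /(mixed_all _ _ hu hx); apply/negP.
have pigeon (p q : K) : (forall u : K, (u + 1) ^+ d + u ^+ d = b -> u = p \/ u = q) ->
    [\/ x = y, y = z | z = x].
  move=> H; case: (H _ hx) (H _ hy) (H _ hz) => -> [] -> [] ->;
  by [constructor 1|constructor 2|constructor 3].
(* For [b = 1] (resp. [-1]) the quadratic equation has a double root, which
   leaves room for the extra solution [0] (resp. [-1]). *)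
have [b1|nb1] := eqVneq b 1.
  apply: (pigeon 0 (-2)) => u hu; case: (sum_cases hu) => [[-> _]|[_ bE]|tu|/not_mixed//].
  - by left.
  - by have := neq1N1; rewrite -bE b1 eqxx.
  have := same_type_subr1 hu tu; rewrite b1 subrr mul0r => /esym/eqP.
  rewrite oppr_eq0 expf_eq0 addr_eq0 /= /normal; have [u0 _ _] := and3P tu.
  case: ifP => [_ /eqP|/negP nu /eqP E]; first by right.
  have uE : u = 1 by apply: (eq_multiple (k := -1) E); ring.
  by case: nu; rewrite uE expr1n.
have [b1|nbN1] := eqVneq b (-1).
  apply: (pigeon (-1) 1) => u hu; case: (sum_cases hu) => [[_ bE]|[-> _]|tu|/not_mixed//].
  - by case/eqP: neq1N1; rewrite -[RHS]b1.
  - by left.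
  have := same_type_addr1 hu tu; rewrite b1 addNr mul0r => /esym/eqP.
  rewrite expf_eq0 subr_eq0 /= /normal; have [u0 u1 /eqP h] := and3P tu.
  case: ifP => [_ /eqP|/negP nu /eqP E]; first by right.
  have uE : u + 1 = -1 by apply: (eq_multiple (k := -1) E); ring.
  by case: nu; rewrite -h uE chiN expr1n.
have same (u : K) : (u + 1) ^+ d + u ^+ d = b -> same_type u.
  move=> hu; case: (sum_cases hu) => [[_ bE]|[_ bE]|//|/not_mixed//].
    by rewrite bE eqxx in nb1.
  by rewrite bE eqxx in nbN1.
exact: same_type_three b0 hx hy hz (same _ hx) (same _ hy) (same _ hz).
Qed.

(** * Upper bound in every direction *)

Lemma expf_pm (x y : K) : x ^+ d = y ^+ d -> x = y \/ x = - y.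
Proof.
move=> h; have d0 : (0 < d)%N by case: (d) odd_d.
have [x0|x0] := eqVneq x 0.
  have /eqP : y ^+ d = 0 by rewrite -h x0 expr0n eqn0Ngt d0.
  by rewrite expf_eq0 d0 /= => /eqP ->; left.
have y0 : y != 0.
  by apply: contra x0 => /eqP y0; move/eqP: h; rewrite y0 expr0n eqn0Ngt d0 expf_eq0 d0.
have : chi x * y = chi y * x by rewrite -!exp_chi h; ring.
by case: (chi_sign x0) (chi_sign y0) => -> [] ->; rewrite ?mulN1r ?mul1r;
  [left|right; apply: oppr_inj; rewrite opprK|right|left; apply: oppr_inj].
Qed.

Lemma cdelta_le2 (a b : K) : (cdelta (-1)%R (fun x => x ^+ d)%R a b <= 2)%N.
Proof.
rewrite leqNgt; apply/negP => /card_gt2P[x [y [z [[]]]]].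
rewrite !inE !mulN1r !opprK => /eqP hx /eqP hy /eqP hz [/eqP xy /eqP yz /eqP zx].
(* For [a = 0] the equation fixes [u ^+ d], hence [u] up to sign. *)
have [a0|a0] := eqVneq a 0.
  have E (u : K) : (u + a) ^+ d + u ^+ d = 2 * u ^+ d by rewrite a0 addr0; ring.
  move: hx hy hz; rewrite !E => hx hy hz.
  have /(mulfI two_neq0)/expf_pm [//|exy] : 2 * x ^+ d = 2 * y ^+ d by rewrite hx hy.
  have /(mulfI two_neq0)/expf_pm [ezx|ezx] : 2 * z ^+ d = 2 * y ^+ d by rewrite hz hy.
    by rewrite ezx in yz.
  by rewrite ezx exy in zx.
have sc (u : K) : (u + a) ^+ d + u ^+ d = b ->
    (u / a + 1) ^+ d + (u / a) ^+ d = b / a ^+ d.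
  move=> <-; have -> : u / a + 1 = (u + a) / a by rewrite mulrDl divff.
  by rewrite !expr_div_n mulrDl.
by case: (no_three_solutions (sc _ hx) (sc _ hy) (sc _ hz)) => /(divIf a0).
Qed.

(** * A value attained twice *)

Lemma expf_chi (x : K) : x != 0 -> x ^+ d = chi x / x.
Proof. by move=> x0; rewrite -exp_chi mulfK. Qed.

(* Writing [b + 1 = u ^+ 2] and [b - 1 = v ^+ 2] with [u - v = w] and
   [u + v = 2 / w] gives [b = (1 - w ^+ 4) / w ^+ 2], and the quadratic equation
   then has the roots [w ^+ 2 / (1 - w ^+ 2)] and [- (1 + w ^+ 2)^-1]. *)
Lemma cdelta_ge2 : (9 < #|K|)%N ->
  exists b : K, (2 <= cdelta (-1)%R (fun x => x ^+ d)%R 1%R b)%N.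
Proof.
move=> hK; have [w hw] := exists_expfn_neq (hK : (1 < 9 < #|K|)%N).
(* The product is [w - w ^+ 9]; its factors are the denominators and, in [w ^+ 4 + 1], the numerator
   of the difference of the two roots. *)
have : w * ((1 - w ^+ 2) * (1 + w ^+ 2)) * (w ^+ 4 + 1) != 0.
  apply: contra hw => /eqP h; apply/eqP/(eq_multiple (k := -1) h); ring.
rewrite !mulf_eq0 !negb_or => /andP[/and3P[w0 m0 p0] q0].
have chiw2 : chi (w ^+ 2) = 1.
  by case: (chi_sign (expf_neq0 2 w0)) => // /eqP; rewrite (negPf (chi_sqr_neq w)).
have chiV (u : K) : chi u^-1 = (chi u)^-1 by rewrite exprVn.
set m := 1 - w ^+ 2 in m0; set p := 1 + w ^+ 2 in p0.
have signV (u : K) : u != 0 -> (chi u)^-1 = chi u.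
  by move=> /chi_sign[] ->; rewrite ?invrN invr1.
pose b := m * p / w ^+ 2.
have S1 : (w ^+ 2 / m + 1) ^+ d + (w ^+ 2 / m) ^+ d = chi m * b.
  have -> : w ^+ 2 / m + 1 = m^-1 by rewrite /m; field.
  rewrite !expf_chi ?mulf_neq0 ?invr_neq0 ?expf_neq0 //.
  rewrite exprMn chiw2 chiV signV // /b; move: (chi m) => e.
  by rewrite /p; move: m0; rewrite /m => m0; field; rewrite w0 m0 oner_eq0.
have S2 : (- p^-1 + 1) ^+ d + (- p^-1) ^+ d = chi p * b.
  have -> : - p^-1 + 1 = w ^+ 2 / p by rewrite /p; field.
  rewrite !expf_chi ?mulf_neq0 ?oppr_eq0 ?invr_neq0 ?expf_neq0 //.
  rewrite exprMn chiw2 chiN chiV signV // /b; move: (chi p) => e.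
  by rewrite /m; move: p0; rewrite /p => p0; field; rewrite w0 p0 ?oppr_eq0 ?oner_eq0.
exists (chi m * b).
have two (x y : K) : x != y -> (x + 1) ^+ d + x ^+ d = chi m * b ->
    (y + 1) ^+ d + y ^+ d = chi m * b ->
    (2 <= cdelta (-1)%R (fun x => x ^+ d)%R 1%R (chi m * b)%R)%N.
  move=> xy hx hy; apply/card_gt1P; exists x, y.
  by rewrite !inE !mulN1r !opprK hx hy eqxx.
(* If the signs differ, the second root is reflected, which negates its value. *)
have [e|ne] := eqVneq (chi p) (chi m).
  apply: (two (w ^+ 2 / m) (- p^-1)) => //; last by rewrite S2 e.
  apply: contra q0 => /eqP E; apply/eqP.
  have -> : w ^+ 4 + 1 = (w ^+ 2 / m - - p^-1) * (m * p).
    by move: m0 p0; rewrite /m /p => m0 p0; field; rewrite m0 p0.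
  by rewrite E subrr mul0r.
apply: (two (w ^+ 2 / m) (-1 - - p^-1)) => //.
  apply: contra two_neq0 => /eqP E; apply/eqP.
  have -> : (2 : K) = (w ^+ 2 / m - (-1 - - p^-1)) * (m * p) / w ^+ 2.
    by move: m0 p0; rewrite /m /p => m0 p0; field; rewrite m0 p0 w0.
  by rewrite E subrr !mul0r.
rewrite sum_refl S2; move: ne.
by case: (chi_sign m0) (chi_sign p0) => -> [] ->; rewrite ?eqxx // ?mulN1r ?opprK mul1r.
Qed.

End QuadraticCharacter.

(* The bound is 1 < n rather than 0 < n: for n = 1 the exponent is 1, and
   x + a + x = b has exactly one solution in F_5, so the uniformity is 1. *)
Theorem theorem14 (K : finFieldType) (n : nat) (hn : (1 < n)%N)
    (hK : #|K| = (5 ^ n)%N) :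
  cdiff_uniformity (-1 : K) (fun x : K => x ^+ ((5 ^ n - 3) %/ 2)) = 2%N.
Proof.
set d := ((5 ^ n - 3) %/ 2)%N.
(* The base 25 is the case [n = 2]; this form yields both the parity of [d] and [9 < #|K|]. *)
have [k kE] : exists k, (5 ^ n = 4 * k + 25)%N.
  case: n hn {hK} @d => [//|[//|n]] _; elim: n => [|n [k E]]; first by exists 0%N.
  by exists (5 * k + 25)%N; rewrite expnS E; lia.
have dE : d = (2 * k + 11)%N by rewrite /d kE; lia.
have cardK : #|K| = (2 * d + 3)%N by rewrite hK kE dE; lia.
have odd_d : odd d by rewrite dE; lia.
have char5 : 5%:R = 0 :> K by have /andP[_ /eqP] := card_finPcharP hK isT.
apply/eqP; rewrite eqn_leq; apply/andP; split.
  by apply/bigmax_leqP => a _; apply/bigmax_leqP => b _; exact: cdelta_le2.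
have [|b hb] := cdelta_ge2 cardK odd_d char5; first by rewrite hK kE; lia.
apply: leq_trans hb _; rewrite /cdiff_uniformity.
apply: (bigmax_sup 1) => //; first by rewrite oner_eq0 implybT.
exact: (bigmax_sup b).
Qed.
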